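(* Let $K$ be a local field of characteristic $p>0$ and $A$ a commutative unital $K$-Banach algebra which is an integral domain. Let $\chi:U^{(1)}_K\to A^\times$ be a locally $K$-analytic character. Then $\chi$ factors over the inclusion $U^{(1)}_K\hookrightarrow A^\times$, and there exists $c\in\mathbb{Z}_p$ such that $\chi=\chi_c$, where $$\chi_c(z)=z^c:=\sum_{n=0}^\infty\binom{c}{n}(z-1)^n\quad\text{for all }z\in U^{(1)}_K.$$ Moreover, the values at $1$ of all $p^i$-th hyperderivatives of $\chi$ lie in $\mathbb{F}_p\subset A$, and $c$ is uniquely determined by $c_i\equiv D^{(p^i)}\chi(1)\bmod p$, where $c=\sum_{i\ge0}c_ip^i$ is the $p$-adic expansion.
   Context: $U^{(1)}_K=\{z\in\mathcal{O}_K:z\equiv1\bmod\mathfrak{m}_K\}$ is the group of principal units, a locally $K$-analytic Lie group. A character $\chi$ is locally $K$-analytic if $U^{(1)}_K\to A^\times\hookrightarrow A$ is locally given by convergent power series with coefficients in $A$. For $c\in\mathbb{Z}_p$ and $n\ge0$ the binomial coefficient $\binom{c}{n}\in\mathbb{F}_p$ is defined via Lucas's theorem: $\binom{c}{n}:=\prod_{i}\binom{c_i}{n_i}\bmod p$ for $p$-adic expansions $c=\sum c_ip^i$, $n=\sum n_ip^i$ (with $\binom{a}{b}=0$ for $a<b$). For a power series $f(z)=\sum a_n(z-z_0)^n$, the $k$-th hyperderivative is $D^{(k)}f(z)=\sum_{n\ge k}\binom{n}{k}a_n(z-z_0)^{n-k}$. *)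

(* Defs.v *)
From HB Require Import structures.
From mathcomp Require Import all_boot all_order all_algebra.
From mathcomp Require Import all_classical all_reals all_analysis.

Set Implicit Arguments.
Unset Strict Implicit.
Unset Printing Implicit Defensive.

Import Order.TTheory GRing.Theory Num.Theory.
Import numFieldNormedType.Exports.
Local Open Scope classical_set_scope.
Local Open Scope ring_scope.

(** * Ultrametric norms, infinite sums, completeness *)

Record ultrametric_norm (R : realType) (V : zmodType) (nrm : V -> R) : Prop :=
  UltrametricNorm {
    ultra_ge0 : forall x, 0 <= nrm x;
    ultra_eq0 : forall x, nrm x = 0 <-> x = 0;
    ultra_sub : forall x y, nrm (x - y) <= Num.max (nrm x) (nrm y) }.

Definition has_sum (R : realType) (V : zmodType) (nrm : V -> R)
    (u : nat -> V) (l : V) : Prop :=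
  (fun N : nat => nrm (\sum_(n < N) u n - l)) @ \oo --> (0 : R).

(* The sum of a convergent series; 0 if the series diverges. *)
Definition infsum (R : realType) (V : zmodType) (nrm : V -> R)
    (u : nat -> V) : V :=
  xget 0 [set l | has_sum nrm u l].

Definition complete_norm (R : realType) (V : zmodType) (nrm : V -> R) : Prop :=
  forall u : nat -> V,
    (forall e : R, 0 < e -> exists N : nat, forall m n : nat,
        (N <= m)%N -> (N <= n)%N -> nrm (u m - u n) < e) ->
    exists l : V, (fun n : nat => nrm (u n - l)) @ \oo --> (0 : R).

(** * Local fields *)

Definition int_ring (R : realType) (K : fieldType) (abs : K -> R) : {pred K} :=
  [pred z | abs z <= 1].

Definition max_ideal (R : realType) (K : fieldType) (abs : K -> R) : {pred K} :=
  [pred z | abs z < 1].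

Definition principal_units (R : realType) (K : fieldType) (abs : K -> R) :
    {pred K} :=
  [pred z | (z \in int_ring abs) && (z - 1 \in max_ideal abs)].

(* Non-archimedean local fields: complete for a (nontrivial) discrete absolute
   value, with finite residue field.  The absolute value is only required to be
   one of those inducing the topology; no normalization is imposed. *)
Record local_field (R : realType) (K : fieldType) (abs : K -> R) : Prop :=
  LocalField {
    lf_norm : ultrametric_norm abs;
    lf_absM : {morph abs : x y / x * y};
    lf_complete : complete_norm abs;
    lf_discrete : exists pi : K, 0 < abs pi < 1 /\
      forall x : K, x != 0 -> exists n : int, abs x = abs pi ^ n;
    (* finitely many cosets of the maximal ideal cover the ring of integers *)
    lf_residue_finite : exists s : seq K, forall x : K, x \in int_ring abs ->
      exists2 y : K, y \in s & x - y \in max_ideal abs }.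

(** * Banach algebras and locally analytic functions *)

(* The norm of 1 is not required to be 1. *)
Record banach_algebra (R : realType) (K : fieldType) (abs : K -> R)
    (A : comUnitAlgType K) (nrm : A -> R) : Prop :=
  BanachAlgebra {
    ba_norm : ultrametric_norm nrm;
    ba_scale : forall (a : K) (x : A), nrm (a *: x) = abs a * nrm x;
    ba_mul : forall x y : A, nrm (x * y) <= nrm x * nrm y;
    ba_complete : complete_norm nrm }.

(* On the part of [U] at distance < [e] from [z0], the function [f] is the sum
   of the power series with center [z0] and coefficients [a].  Values of [f]
   outside [U] play no role, here and below. *)
Definition power_series_expansion (R : realType) (K : fieldType) (abs : K -> R)
    (A : comUnitAlgType K) (nrm : A -> R) (U : {pred K}) (f : K -> A)
    (z0 : K) (a : nat -> A) (e : R) : Prop :=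
  forall z : K, z \in U -> abs (z - z0) < e ->
    has_sum nrm (fun n => (z - z0) ^+ n *: a n) (f z).

Definition locally_analytic (R : realType) (K : fieldType) (abs : K -> R)
    (A : comUnitAlgType K) (nrm : A -> R) (U : {pred K}) (f : K -> A) : Prop :=
  forall z0 : K, z0 \in U -> exists (a : nat -> A) (e : R),
    0 < e /\ power_series_expansion abs nrm U f z0 a e.

(* [v] is the value at [z] of the [k]-th hyperderivative of some power series
   expansion of [f] valid around [z].  The terms with n < k vanish because
   ['C(n, k) = 0]. *)
Definition is_hyperderiv (R : realType) (K : fieldType) (abs : K -> R)
    (A : comUnitAlgType K) (nrm : A -> R) (U : {pred K}) (f : K -> A)
    (k : nat) (z : K) (v : A) : Prop :=
  exists (z0 : K) (a : nat -> A) (e : R),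
    [/\ z0 \in U, z \in U, power_series_expansion abs nrm U f z0 a e,
        abs (z - z0) < e
      & has_sum nrm (fun n => (z - z0) ^+ (n - k) *: (a n *+ 'C(n, k))) v].

Definition hyperderiv (R : realType) (K : fieldType) (abs : K -> R)
    (A : comUnitAlgType K) (nrm : A -> R) (U : {pred K}) (f : K -> A)
    (k : nat) (z : K) : A :=
  xget 0 [set v | is_hyperderiv abs nrm U f k z v].

(** * p-adic integers and binomial coefficients *)

(* The inverse limit of the Z/p^n, with residues represented in [0, p^n[. *)
Record padic_int (p : nat) := PadicInt {
  padic_res : nat -> nat;
  padic_res_lt : forall n, (padic_res n < p ^ n)%N;
  padic_res_coh : forall n, (padic_res n.+1 %% p ^ n)%N = padic_res n }.

Definition padic_digit (p : nat) (c : padic_int p) (i : nat) : nat :=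
  (padic_res c i.+1 %/ p ^ i)%N.

Lemma padic_digit_lt (p : nat) (c : padic_int p) (i : nat) :
  (padic_digit c i < p)%N.
Proof.
have := padic_res_lt c i.+1; rewrite /padic_digit expnS => h.
rewrite ltn_divLR //; case: (posnP (p ^ i)%N) h => // ->.
by rewrite muln0.
Qed.

Lemma padic_expansion (p : nat) (c : padic_int p) (n : nat) :
  padic_res c n = (\sum_(i < n) padic_digit c i * p ^ i)%N.
Proof.
elim: n => [|n IHn].
  by rewrite big_ord0; have := padic_res_lt c 0; rewrite expn0; case: padic_res.
by rewrite big_ord_recr /= -IHn [LHS](divn_eq _ (p ^ n)) padic_res_coh addnC.
Qed.

Definition nat_digit (p n i : nat) : nat := ((n %/ p ^ i) %% p)%N.

(* For p > 1, the digits of n of index i >= n vanish, so that the remaining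
   factors of the product are all equal to 1. *)
Definition padic_binomial (p : nat) (c : padic_int p) (n : nat) : 'F_p :=
  (\prod_(i < n) 'C(padic_digit c i, nat_digit p n i))%:R.

(* A ring morphism when S has characteristic p. *)
Definition Fp_incl (p : nat) (S : nzRingType) (x : 'F_p) : S := (x : nat)%:R.

Definition padic_power_term (p : nat) (K : fieldType) (c : padic_int p)
    (z : K) (n : nat) : K :=
  Fp_incl K (padic_binomial c n) * (z - 1) ^+ n.

Definition padic_power (p : nat) (R : realType) (K : fieldType) (abs : K -> R)
    (c : padic_int p) (z : K) : K :=
  infsum abs (padic_power_term c z).

(* Main.v *)
Require Import Defs.
From HB Require Import structures.
From mathcomp Require Import all_boot all_order all_algebra.
From mathcomp Require Import all_classical all_reals all_analysis.

(** Near 1 write chi(1 + y) = sum_n a_n y^n.  Recentering the left-hand side of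
    chi((1 + y)(1 + x)) = chi(1 + y) chi(1 + x) at y and comparing coefficients
    of x^m gives (1 + y)^m D^(m)chi(1 + y) = a_m chi(1 + y).  For m = p^i one
    has (1 + y)^m = 1 + y^m, and comparing coefficients of y^n gives
      (n_i + 1) a_(n + p^i) = (a_(p^i) - n_i) a_n,
    n_i being the i-th base p digit of n.  Running n_i from 0 to p - 1 shows
    prod_(j < p) (a_(p^i) - j) = 0, so that a_(p^i) is the class of some digit
    c_i because A is a domain; the recursion then yields
    a_n = prod_i binom(c_i, n_i), that is, chi(z) = z^c near 1.  Since
    chi(z)^p = chi(z^p) and (z^p)^c = (z^c)^p, and the Frobenius of A is
    injective, this identity propagates to all principal units. *)

Set Implicit Arguments.
Unset Strict Implicit.
Unset Printing Implicit Defensive.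

Import Order.TTheory GRing.Theory Num.Theory.
Local Open Scope ring_scope.

(** * Ultrametric series *)

Section Ultrametric.
Variables (R : realType) (V : zmodType) (nrm : V -> R).
Hypothesis hn : ultrametric_norm nrm.

Lemma ultra_norm0 : nrm 0 = 0.
Proof. exact/(ultra_eq0 hn). Qed.

Lemma ultra_normN x : nrm (- x) = nrm x.
Proof.
have le y : nrm (- y) <= nrm y.
  have := ultra_sub hn 0 y.
  by rewrite sub0r ultra_norm0 max_r // (ultra_ge0 hn).
by apply/eqP; rewrite eq_le le /= -{1}(opprK x) le.
Qed.

Lemma ultra_distC x y : nrm (x - y) = nrm (y - x).
Proof. by rewrite -ultra_normN opprB. Qed.

Lemma ultra_subr_le x y e : nrm x <= e -> nrm y <= e -> nrm (x - y) <= e.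
Proof. by move=> xe ye; rewrite (le_trans (ultra_sub hn x y)) // ge_max xe. Qed.

Lemma ultra_add_le x y e : nrm x <= e -> nrm y <= e -> nrm (x + y) <= e.
Proof.
by move=> xe ye; rewrite -[y]opprK ultra_subr_le // ultra_normN.
Qed.

Lemma ultra_add_lt x y e : nrm x < e -> nrm y < e -> nrm (x + y) < e.
Proof.
move=> xe ye; rewrite -[y]opprK (le_lt_trans (ultra_sub hn x (- y))) //.
by rewrite gt_max xe ultra_normN.
Qed.

Lemma ultra_sum_le (I : Type) (r : seq I) (P : pred I) (F : I -> V) e :
  0 <= e -> (forall i, P i -> nrm (F i) <= e) ->
  nrm (\sum_(i <- r | P i) F i) <= e.
Proof.
move=> e0 Fe; apply: (big_ind (fun x => nrm x <= e)) => //.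
  by rewrite ultra_norm0.
by move=> x y; apply: ultra_add_le.
Qed.

(** A multiple is a sum of [n] copies of [x]. Hence binomial coefficients are harmless in all later
    estimates. *)
Lemma ultra_muln_le x n : nrm (x *+ n) <= nrm x.
Proof.
by rewrite -[n]card_ord -sumr_const ultra_sum_le // (ultra_ge0 hn).
Qed.

Definition null_seq (u : nat -> V) :=
  forall e : R, 0 < e -> exists N, forall n, (N <= n)%N -> nrm (u n) < e.

Lemma has_sumP (u : nat -> V) l :
  has_sum nrm u l <-> null_seq (fun N => \sum_(n < N) u n - l).
Proof.
have nn x : `|nrm x| = nrm x by rewrite ger0_norm // (ultra_ge0 hn).
split=> [/cvgr0Pnorm_lt ul e e0 | ul].
  have [N _ Nu] := ul e e0.
  by exists N => n Nn; have := Nu n Nn; rewrite /= nn.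
apply/cvgr0Pnorm_lt => e e0.
have [N Nu] := ul e e0; exists N => // n /= Nn.
by rewrite nn Nu.
Qed.

Lemma null_seq_const x : null_seq (fun=> x) -> x = 0.
Proof.
move=> hx; apply/(ultra_eq0 hn)/eqP; rewrite eq_le (ultra_ge0 hn) andbT.
rewrite leNgt; apply/negP => /hx[N /(_ N (leqnn N))].
by rewrite ltxx.
Qed.

Lemma null_seqB u v : null_seq u -> null_seq v -> null_seq (fun n => u n - v n).
Proof.
move=> hu hv e e0; have [N Nu] := hu e e0; have [M Mv] := hv e e0.
exists (maxn N M) => n; rewrite geq_max => /andP[/Nu un /Mv vn].
by rewrite ultra_add_lt // ultra_normN.
Qed.

Lemma null_seq_bounded u :
  null_seq u -> exists2 C, 0 < C & forall n, nrm (u n) <= C.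
Proof.
move=> hu; have [N Nu] := hu 1 ltr01.
have S0 : 0 <= \sum_(i < N) nrm (u i).
  by rewrite sumr_ge0 // => i _; rewrite (ultra_ge0 hn).
exists (1 + \sum_(i < N) nrm (u i)) => [|n]; first by rewrite ltr_wpDr.
have [/Nu/ltW un|nN] := leqP N n; first by rewrite (le_trans un) // lerDl.
rewrite (bigD1 (Ordinal nN)) //= addrCA lerDl addr_ge0 // sumr_ge0 // => i _.
by rewrite (ultra_ge0 hn).
Qed.

Lemma has_sum_eq u v l : u =1 v -> has_sum nrm u l -> has_sum nrm v l.
Proof. by move/funext => ->. Qed.

Lemma has_sum_unique u l l' : has_sum nrm u l -> has_sum nrm u l' -> l = l'.
Proof.
move=> /has_sumP ul /has_sumP ul'; apply/eqP; rewrite -subr_eq0; apply/eqP.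
apply: null_seq_const; apply: eq_ind (null_seqB ul' ul) _ _.
by apply/funext => N; rewrite addrC opprB addrA subrK.
Qed.

Lemma has_sum_infsum u l : has_sum nrm u l -> infsum nrm u = l.
Proof.
move=> ul; apply: has_sum_unique (ul).
by apply: (xgetPex 0 (P := [set l | has_sum nrm u l]%classic)); exists l.
Qed.

Lemma sum_ordB (u : nat -> V) m n : (m <= n)%N ->
  \sum_(i < n) u i - \sum_(i < m) u i = \sum_(m <= i < n) u i.
Proof.
move=> mn; rewrite -!(big_mkord xpredT u) (big_cat_nat (leq0n m) mn) /=.
by rewrite addrAC subrr add0r.
Qed.

Lemma has_sum_null_seq u l : has_sum nrm u l -> null_seq u.
Proof.
move=> /has_sumP ul e /ul[N Nu]; exists N => n Nn.
have -> : u n = (\sum_(i < n.+1) u i - l) - (\sum_(i < n) u i - l).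
  by rewrite opprB addrA subrK big_ord_recr addrAC subrr add0r.
by rewrite ultra_add_lt ?ultra_normN ?Nu // ltnW.
Qed.

(** Ultrametric convergence criterion: a difference of partial sums is no larger than its largest
    term, so null terms already make the partial sums Cauchy. *)
Lemma null_seq_has_sum u :
  complete_norm nrm -> null_seq u -> exists l, has_sum nrm u l.
Proof.
move=> hc hu; apply: hc => e e0.
(* Halving [e] turns the non-strict bound of [ultra_sum_le] into a strict one. *)
have e20 : 0 < e / 2 by rewrite divr_gt0.
have [N Nu] := hu _ e20; exists N.
suff H m n : (N <= m)%N -> (m <= n)%N ->
    nrm (\sum_(i < n) u i - \sum_(i < m) u i) < e.
  move=> m n Nm Nn; have [mn|/ltnW nm] := leqP m n; last exact: H.
  by rewrite ultra_distC H.
move=> Nm mn; rewrite sum_ordB // (@le_lt_trans _ _ (e / 2)) //.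
  rewrite big_nat ultra_sum_le ?ltW // => i /andP[mi _].
  by rewrite ltW // Nu // (leq_trans Nm).
by rewrite ltr_pdivrMr // ltr_pMr // ltr1n.
Qed.

(** If the tail were larger than [e], a late partial sum would be closer to [l] than the norm of the
    tail, while lying within [e] of the [N]-th one; adding the two differences would bound the tail
    strictly by itself. *)
Lemma has_sum_tail_le u l N e : 0 <= e ->
    (forall n, (N <= n)%N -> nrm (u n) <= e) ->
  has_sum nrm u l -> nrm (l - \sum_(i < N) u i) <= e.
Proof.
move=> e0 Nu /has_sumP ul; rewrite leNgt; apply/negP => le.
have [M Mu] := ul _ (le_lt_trans e0 le).
have := Mu (maxn M N) (leq_maxl _ _); rewrite ltNge => /negP; apply.
set S := \sum_(i < maxn M N) u i.
have SN : nrm (S - \sum_(i < N) u i) <= e.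
  rewrite sum_ordB ?leq_maxr // big_nat ultra_sum_le // => i /andP[Ni _].
  exact: Nu.
rewrite leNgt; apply/negP => Sl.
have : nrm (l - \sum_(i < N) u i) < nrm (l - \sum_(i < N) u i).
  rewrite -[X in X < _]/(nrm _) -{1}(subrK S l) -addrA ultra_add_lt //.
    by rewrite ultra_distC.
  exact: le_lt_trans SN le.
by rewrite ltxx.
Qed.

Lemma has_sumD u v l l' : has_sum nrm u l -> has_sum nrm v l' ->
  has_sum nrm (fun n => u n + v n) (l + l').
Proof.
move=> /has_sumP ul /has_sumP vl'; apply/has_sumP => e e0.
have [N Nu] := ul e e0; have [M Mv] := vl' e e0.
exists (maxn N M) => n; rewrite geq_max => /andP[/Nu un /Mv vn].
by rewrite big_split /= opprD addrACA ultra_add_lt.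
Qed.

Lemma has_sum_drop u l m : has_sum nrm u l ->
  has_sum nrm (fun n => u (n + m)%N) (l - \sum_(i < m) u i).
Proof.
move=> /has_sumP ul; apply/has_sumP => e /ul[N Nu]; exists N => n Nn.
have E : \sum_(i < n + m) u i = \sum_(i < m) u i + \sum_(i < n) u (i + m)%N.
  rewrite addnC big_split_ord /=; congr (_ + _).
  by apply: eq_bigr => i _; rewrite addnC.
rewrite opprB addrCA addrA -E.
by rewrite Nu // (leq_trans Nn) // leq_addr.
Qed.

Lemma has_sum_shift u l m : (forall n, (n < m)%N -> u n = 0) ->
  has_sum nrm u l -> has_sum nrm (fun n => u (n + m)%N) l.
Proof.
move=> u0 /has_sum_drop => /(_ m).
by rewrite big1 ?subr0 // => i _; apply: u0.
Qed.

Lemma has_sum_single u m : (forall n, n != m -> u n = 0) -> has_sum nrm u (u m).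
Proof.
move=> u0; apply/has_sumP => e e0; exists m.+1 => n mn.
rewrite (bigD1 (Ordinal mn)) //= big1 ?addr0 ?subrr ?ultra_norm0 // => i im.
by apply: u0.
Qed.

End Ultrametric.

(** Additivity reduces continuity to continuity at 0. The epsilon-delta form suits the Frobenius
    map, which is not Lipschitz on all of [K]. *)
Lemma has_sum_map (R : realType) (V W : zmodType) (nrm : V -> R)
    (nrm' : W -> R) (f : {additive V -> W}) (u : nat -> V) (l : V) :
  ultrametric_norm nrm -> ultrametric_norm nrm' ->
  (forall e, 0 < e -> exists2 d, 0 < d &
     forall x, nrm x < d -> nrm' (f x) < e) ->
  has_sum nrm u l -> has_sum nrm' (fun n => f (u n)) (f l).
Proof.
move=> hn hn' fc /(has_sumP hn) ul; apply/(has_sumP hn') => e /fc[d d0 fd].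
have [N Nu] := ul d d0; exists N => n Nn.
by rewrite -raddf_sum -raddfB fd // Nu.
Qed.

Lemma has_sum_lipschitz (R : realType) (V W : zmodType) (nrm : V -> R)
    (nrm' : W -> R) (f : {additive V -> W}) (C : R) (u : nat -> V) (l : V) :
  ultrametric_norm nrm -> ultrametric_norm nrm' ->
  (forall x, nrm' (f x) <= C * nrm x) ->
  has_sum nrm u l -> has_sum nrm' (fun n => f (u n)) (f l).
Proof.
move=> hn hn' fC; apply: has_sum_map => // e e0.
(* The sign of [C] is arbitrary, so a positive constant above it is used. *)
have C0 : 0 < `|C| + 1 by rewrite ltr_wpDl.
exists (e / (`|C| + 1)) => [|x xe]; first by rewrite divr_gt0.
rewrite (le_lt_trans (fC x)) // (@le_lt_trans _ _ ((`|C| + 1) * nrm x)) //.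
  rewrite ler_wpM2r ?(ultra_ge0 hn) // (le_trans (ler_norm C)) //.
  by rewrite lerDl.
by rewrite mulrC -ltr_pdivlMr.
Qed.

(** * Power series over a local field *)

Section PowerSeries.
Variables (R : realType) (K : fieldType) (abs : K -> R).
Hypothesis hK : local_field abs.
Variables (A : comUnitAlgType K) (nrm : A -> R).
Hypothesis hA : banach_algebra abs nrm.

Let hn : ultrametric_norm nrm := ba_norm hA.
Let ha : ultrametric_norm abs := lf_norm hK.

Lemma abs_eq0 x : (abs x == 0) = (x == 0).
Proof. by apply/eqP/eqP => /(ultra_eq0 ha). Qed.

Lemma abs_gt0 x : (0 < abs x) = (x != 0).
Proof. by rewrite lt_def (ultra_ge0 ha) andbT abs_eq0. Qed.

Lemma abs1 : abs 1 = 1.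
Proof.
have a1 : abs 1 != 0 by rewrite abs_eq0 oner_neq0.
by apply: (mulfI a1); rewrite -(lf_absM hK) !mulr1.
Qed.

Lemma absX x n : abs (x ^+ n) = abs x ^+ n.
Proof.
by elim: n => [|n IHn]; rewrite ?expr0 ?abs1 // !exprS (lf_absM hK) IHn.
Qed.

(** Integrality of [z] is automatic, because [z] is the sum of [z - 1] and 1. *)
Lemma principal_unitsP z :
  reflect (abs (z - 1) < 1) (z \in principal_units abs).
Proof.
rewrite inE; apply: (iffP andP) => [[]//|z1]; split=> //.
by rewrite inE -(subrK 1 z) (ultra_add_le ha) ?abs1 // ltW.
Qed.

Lemma principal_units_add1 x : abs x < 1 -> 1 + x \in principal_units abs.
Proof. by move=> x1; apply/principal_unitsP; rewrite addrAC subrr add0r. Qed.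

Lemma abs_principal_unit z : z \in principal_units abs -> abs z = 1.
Proof.
move=> /principal_unitsP z1; apply/eqP; rewrite eq_le; apply/andP; split.
  by rewrite -(subrK 1 z) (ultra_add_le ha) ?abs1 // ltW.
rewrite leNgt; apply/negP => zlt1; have : abs 1 < 1.
  by rewrite -{1}(subKr z 1) (ultra_add_lt ha) ?(ultra_normN ha).
by rewrite abs1 ltxx.
Qed.

Lemma principal_units1 : 1 \in principal_units abs.
Proof. by apply/principal_unitsP; rewrite subrr (ultra_norm0 ha). Qed.

Lemma principal_unitsM z w : z \in principal_units abs ->
  w \in principal_units abs -> z * w \in principal_units abs.
Proof.
move=> zU /principal_unitsP w1; apply/principal_unitsP.
have -> : z * w - 1 = z * (w - 1) + (z - 1) by rewrite mulrBr mulr1 addrA subrK.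
rewrite (ultra_add_lt ha) //; last exact/principal_unitsP.
by rewrite (lf_absM hK) (abs_principal_unit zU) mul1r.
Qed.

Lemma principal_unitsX z n :
  z \in principal_units abs -> z ^+ n \in principal_units abs.
Proof.
move=> zU; elim: n => [|n IHn]; first exact: principal_units1.
by rewrite exprS principal_unitsM.
Qed.

Lemma expr_lt_eventually (t e : R) : 0 <= t < 1 -> 0 < e ->
  exists N, forall n, (N <= n)%N -> t ^+ n < e.
Proof.
move=> /andP[t0 t1] e0; have : `|t| < 1 by rewrite ger0_norm.
move=> /cvg_expr/cvgr0Pnorm_lt/(_ e e0)[N _ Nt]; exists N => n Nn.
by rewrite (le_lt_trans (ler_norm _)) // Nt.
Qed.

Lemma small_element (e : R) : 0 < e -> exists2 x : K, x != 0 & abs x < e.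
Proof.
have [pi [/andP[pi0 pi1] _]] := lf_discrete hK.
have piR : 0 <= abs pi < 1 by rewrite ltW.
move=> /(expr_lt_eventually piR)[N /(_ N (leqnn N)) piN].
by exists (pi ^+ N); rewrite ?absX // expf_neq0 // -abs_gt0.
Qed.

(** Identity theorem. If [b n] is the first nonzero coefficient, then at suitable points close to 0
    its term is strictly larger than the whole tail, so the sum cannot be 0. *)
Lemma power_series_eq0 (b : nat -> A) (e : R) : 0 < e ->
  (forall x, abs x < e -> has_sum nrm (fun n => x ^+ n *: b n) 0) ->
  forall n, b n = 0.
Proof.
move=> e0 hb; elim/ltn_ind => n IHn; apply/eqP; apply: contraT => bn0.
have [r r0 re] := small_element e0.
have [C C0 hC] := null_seq_bounded hn (has_sum_null_seq hn (hb r re)).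
have rb0 : 0 < nrm (r ^+ n *: b n).
  rewrite lt_def (ultra_ge0 hn) andbT; apply/eqP => /(ultra_eq0 hn)/eqP.
  by rewrite scaler_eq0 expf_eq0 (negPf r0) andbF (negPf bn0).
(* This bound on [s] makes the tail estimate [abs s ^+ n.+1 * C] at [s * r] fall below the norm of
   the term of index [n]. *)
have t0 : 0 < Num.min 1 (nrm (r ^+ n *: b n) / C).
  by rewrite lt_min ltr01 divr_gt0.
have [s s0] := small_element t0; rewrite lt_min => /andP[s1].
rewrite ltr_pdivlMr //; apply: contraTT => _; rewrite -leNgt.
have rse : abs (s * r) < e.
  by rewrite (lf_absM hK) (le_lt_trans _ re) // ler_piMl ?(ultra_ge0 ha) // ltW.
have sn0 : 0 < abs s ^+ n by rewrite exprn_gt0 // abs_gt0.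
rewrite -(ler_pM2l sn0) mulrA -exprSr -absX -(ba_scale hA) scalerA -exprMn.
have := has_sum_tail_le hn (N := n.+1) (e := abs (s ^+ n.+1) * C) _ _ (hb _ rse).
rewrite big_ord_recr /= big1 => [|i _]; last by rewrite IHn ?scaler0.
rewrite !add0r (ultra_normN hn) -absX; apply=> [|k nk].
  by rewrite mulr_ge0 ?(ultra_ge0 ha) // ltW.
rewrite exprMn -scalerA (ba_scale hA) ler_pM ?(ultra_ge0 ha) ?(ultra_ge0 hn) //.
by rewrite !absX ler_wiXn2l ?(ultra_ge0 ha) // ltW.
Qed.

Lemma power_series_unique (b b' : nat -> A) (f : K -> A) (e : R) : 0 < e ->
  (forall x, abs x < e -> has_sum nrm (fun n => x ^+ n *: b n) (f x)) ->
  (forall x, abs x < e -> has_sum nrm (fun n => x ^+ n *: b' n) (f x)) ->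
  b =1 b'.
Proof.
move=> e0 hb hb' n; apply/eqP; rewrite -subr_eq0; apply/eqP.
apply: (power_series_eq0 (b := fun n => b n - b' n) e0) => x xe.
rewrite -(subrr (f x)).
have hN : has_sum nrm (fun n => - (x ^+ n *: b' n)) (- f x).
  apply: (has_sum_lipschitz (f := -%R) (C := 1) hn hn _ (hb' x xe)) => y.
  by rewrite mul1r (ultra_normN hn).
by apply: has_sum_eq (has_sumD hn (hb x xe) hN) => k /=; rewrite scalerBr.
Qed.

Lemma has_sum_scaler c (u : nat -> A) l :
  has_sum nrm u l -> has_sum nrm (fun n => c *: u n) (c *: l).
Proof.
apply: (has_sum_lipschitz (f := *:%R c) (C := abs c)) => // x.
by rewrite (ba_scale hA).
Qed.

Lemma has_sum_mull c (u : nat -> A) l :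
  has_sum nrm u l -> has_sum nrm (fun n => c * u n) (c * l).
Proof.
apply: (has_sum_lipschitz (f := c \*o idfun) (C := nrm c)) => // x.
exact: (ba_mul hA).
Qed.

Lemma has_sum_alg (u : nat -> K) l :
  has_sum abs u l -> has_sum nrm (fun n => (u n)%:A) (l%:A : A).
Proof.
(* The Lipschitz constant is [nrm 1], which may differ from 1. *)
apply: (has_sum_lipschitz (f := in_alg A) (C := nrm 1)) => // x.
by rewrite /= (ba_scale hA) mulrC.
Qed.

(** After multiplication by [abs r ^+ j], the norm of the term of index [n >= j] is at most that of
    [r ^+ n *: b n]. *)
Lemma hyperderiv_terms_null (b : nat -> A) (r y : K) j : r != 0 ->
  abs y <= abs r -> null_seq nrm (fun n => r ^+ n *: b n) ->
  null_seq nrm (fun n => y ^+ (n - j) *: (b n *+ 'C(n, j))).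
Proof.
move=> r0 yr hr e e0; have rj0 : 0 < abs r ^+ j by rewrite exprn_gt0 // abs_gt0.
have [N Nr] := hr _ (mulr_gt0 rj0 e0); exists (maxn N j) => n.
rewrite geq_max => /andP[Nn jn].
rewrite -(ltr_pM2l rj0); apply: le_lt_trans (Nr n Nn).
have E : abs r ^+ n = abs r ^+ j * abs r ^+ (n - j) by rewrite -exprD subnKC.
rewrite !(ba_scale hA) mulrA !absX E.
rewrite ler_pM ?mulr_ge0 ?exprn_ge0 ?(ultra_ge0 ha) ?(ultra_ge0 hn) //.
  by rewrite ler_pM2l // lerXn2r ?nnegrE ?(ultra_ge0 ha).
exact: ultra_muln_le.
Qed.

(* The double series over (n, j) is unconditionally convergent since its terms
   are bounded by the null sequence |r|^n |b_n|, so the order of summation can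
   be exchanged. *)
Lemma has_sum_recenter (b g : nat -> A) (r x y : K) s : r != 0 ->
  abs x <= abs r -> abs y <= abs r ->
  null_seq nrm (fun n => r ^+ n *: b n) ->
  has_sum nrm (fun n => (y + x) ^+ n *: b n) s ->
  (forall j, has_sum nrm (fun n => y ^+ (n - j) *: (b n *+ 'C(n, j))) (g j)) ->
  has_sum nrm (fun j => x ^+ j *: g j) s.
Proof.
move=> r0 xr yr hr /(has_sumP hn) hs hg; apply/(has_sumP hn) => e e0.
have [N Ns] := hs e e0.
have e20 : 0 < e / 2 by rewrite divr_gt0.
have e2e : e / 2 < e by rewrite ltr_pdivrMr // ltr_pMr // ltr1n.
have [M Mr] := hr _ e20; exists (maxn N M) => n.
rewrite geq_max => /andP[Nn Mn].
rewrite -[\sum_(j < n) _](subrK (\sum_(i < n) (y + x) ^+ i *: b i)) -addrA.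
apply: (ultra_add_lt hn); last exact: Ns.
apply: le_lt_trans e2e.
(* Binomial theorem and exchange of two finite sums; the sum over [j] may run up to [n] because
   ['C(i, j)] vanishes for [i < j]. *)
have -> : \sum_(i < n) (y + x) ^+ i *: b i =
   \sum_(j < n) x ^+ j *: \sum_(i < n) y ^+ (i - j) *: (b i *+ 'C(i, j)).
  under [RHS]eq_bigr do rewrite scaler_sumr.
  rewrite exchange_big /=; apply: eq_bigr => i _.
  rewrite exprDn scaler_suml (big_ord_widen _ (fun j : nat =>
    (y ^+ (i - j) * x ^+ j *+ 'C(i, j)) *: b i) (ltn_ord i)) big_mkcond /=.
  apply: eq_bigr => j _; case: ltnP => [_|ij].
    rewrite -scalerMnl -scalerMnr -scalerA [_ *: (_ *: _)]scalerA -mulrC.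
    by rewrite -scalerMnr scalerA.
  by rewrite bin_small // mulr0n !scaler0.
rewrite -sumrB (ultra_sum_le hn) ?ltW // => j _; rewrite -scalerBr.
have xj0 := exprn_ge0 j (ultra_ge0 ha x).
rewrite (ba_scale hA) absX.
have rj0 : 0 < abs r ^+ j by rewrite exprn_gt0 // abs_gt0.
apply: (@le_trans _ _ (abs r ^+ j * nrm
  (g j - \sum_(i < n) y ^+ (i - j) *: (b i *+ 'C(i, j))))).
  by rewrite ler_wpM2r ?(ultra_ge0 hn) // lerXn2r ?nnegrE ?(ultra_ge0 ha).
(* What remains is the tail of the series of [g j]; its terms are at most [e / 2 / abs r ^+ j],
   since [r ^+ i *: b i] is smaller than [e / 2] from index [M] on. *)
rewrite mulrC -ler_pdivlMr //.
apply: (has_sum_tail_le hn) (hg j); first by rewrite divr_ge0 // ltW.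
move=> i ni; rewrite ler_pdivlMr // mulrC.
have ji : (j <= i)%N by rewrite (leq_trans (ltnW (ltn_ord j))).
apply: le_trans (ltW (Mr i (leq_trans Mn ni))).
have E : abs r ^+ i = abs r ^+ j * abs r ^+ (i - j) by rewrite -exprD subnKC.
rewrite !(ba_scale hA) mulrA !absX E.
rewrite ler_pM ?mulr_ge0 ?exprn_ge0 ?(ultra_ge0 ha) ?(ultra_ge0 hn) //.
  by rewrite ler_pM2l // lerXn2r ?nnegrE ?(ultra_ge0 ha).
exact: ultra_muln_le.
Qed.

End PowerSeries.

(** * Base p digits and the coefficient recursion *)

Section Digits.
Variable p : nat.
Hypothesis p_pr : prime p.

(** By [mul_bin_diag], [p ^ i] divides [j * 'C(p ^ i, j)]. Were the binomial prime to [p], then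
    [p ^ i] would divide the smaller positive number [j]. *)
Lemma dvdn_bin_expn i j : (0 < j < p ^ i)%N -> (p %| 'C(p ^ i, j))%N.
Proof.
case: j => // j /= ji; apply: contraLR ji => pC; rewrite -leqNgt dvdn_leq //.
have := mul_bin_diag (p ^ i) j => E.
have : (p ^ i %| j.+1 * 'C(p ^ i, j.+1))%N by rewrite -E dvdn_mulr.
by rewrite Gauss_dvdl // coprimeXl // prime_coprime.
Qed.

(** In the Vandermonde sum only the two extreme terms survive modulo [p]. *)
Lemma bin_add_expn n i : 'C(n + p ^ i, p ^ i) = 'C(n, p ^ i) + 1 %[mod p].
Proof.
have : (0 < p ^ i)%N by rewrite expn_gt0 prime_gt0.
rewrite -binomial.Vandermonde; have := @dvdn_bin_expn i.
case: (p ^ i)%N => // q pC _.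
rewrite big_ord_recr big_ord_recl /= subnn subn0 !bin0 binn !muln1.
rewrite addnAC -modnDmr (_ : (\sum_(_ < q) _) %% _ = 0)%N; first by rewrite addn0 addnC.
apply/eqP; apply: dvdn_sum => j _.
by rewrite dvdn_mull // pC // /bump /= add1n subSS subn_gt0 ltn_ord ltnS leq_subr.
Qed.

(** A case of Lucas's theorem: adding [p ^ i] to [n] raises both sides by one modulo [p], so
    induction on the quotient applies. *)
Lemma bin_expn_mod n i : 'C(n, p ^ i) = (n %/ p ^ i)%N %[mod p].
Proof.
have q0 : (0 < p ^ i)%N by rewrite expn_gt0 prime_gt0.
rewrite {1}(divn_eq n (p ^ i)); elim: (n %/ p ^ i)%N => [|q IHq].
  by rewrite bin_small // ltn_mod.
by rewrite mulSn -addnA addnC bin_add_expn -modnDml IHq modnDml addn1.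
Qed.

Lemma sum_digits_lt (d : nat -> nat) n :
  (forall i, d i < p)%N -> (\sum_(i < n) d i * p ^ i < p ^ n)%N.
Proof.
move=> dp; elim: n => [|n IHn]; first by rewrite big_ord0.
rewrite big_ord_recr /= expnS -addSn.
rewrite (@leq_trans (p ^ n + d n * p ^ n)) ?leq_add2r //.
by rewrite -mulSn leq_mul2r dp orbT.
Qed.

Lemma sum_digits_coh (d : nat -> nat) n : (forall i, d i < p)%N ->
  ((\sum_(i < n.+1) d i * p ^ i) %% p ^ n = \sum_(i < n) d i * p ^ i)%N.
Proof.
move=> dp; rewrite big_ord_recr /= addnC modnMDl modn_small //.
exact: sum_digits_lt.
Qed.

Definition padic_of_digits (d : nat -> nat) (dp : forall i, (d i < p)%N) :
    padic_int p :=
  PadicInt (fun n => sum_digits_lt n dp) (fun n => sum_digits_coh n dp).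

Lemma padic_of_digitsE (d : nat -> nat) (dp : forall i, (d i < p)%N) i :
  padic_digit (padic_of_digits dp) i = d i.
Proof.
rewrite /padic_digit /= big_ord_recr /= addnC divnMDl ?expn_gt0 ?prime_gt0 //.
by rewrite divn_small ?addn0 // sum_digits_lt.
Qed.

Lemma padic_digit_inj (c c' : padic_int p) :
  padic_digit c =1 padic_digit c' -> c = c'.
Proof.
move=> cc'.
have : padic_res c = padic_res c'.
  by apply/funext => n; rewrite !padic_expansion; under eq_bigr do rewrite cc'.
case: c {cc'} => r rlt rcoh; case: c' => r' r'lt r'coh /= rr'.
by subst r'; congr PadicInt; apply: Prop_irrelevance.
Qed.

Lemma nat_digit_small n i : (n < p ^ i)%N -> nat_digit p n i = 0%N.
Proof. by move=> ni; rewrite /nat_digit divn_small ?mod0n. Qed.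

Lemma nat_digit_top q r N : (q < p)%N -> (r < p ^ N)%N ->
  nat_digit p (q * p ^ N + r) N = q.
Proof.
move=> qp rN; rewrite /nat_digit divnMDl ?expn_gt0 ?prime_gt0 //.
by rewrite (divn_small rN) addn0 modn_small.
Qed.

Lemma nat_digit_low q r i N : (i < N)%N ->
  nat_digit p (q * p ^ N + r) i = nat_digit p r i.
Proof.
move=> iN; rewrite /nat_digit -(subnK iN) addnS -addSn expnD mulnA.
rewrite divnMDl ?expn_gt0 ?prime_gt0 // expnS [(p * _)%N]mulnC mulnA.
by rewrite modnMDl.
Qed.

(** The Lucas product in [nat], with the number [M] of factors kept apart from [n]: [padic_binomial]
    uses [M = n], while induction on digits needs [M] to count the digits. *)
Definition digit_binomial (d : nat -> nat) (M n : nat) : nat :=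
  \prod_(i < M) 'C(d i, nat_digit p n i).

Lemma digit_binomial_widen d M N n : (M <= N)%N -> (n < p ^ M)%N ->
  digit_binomial d N n = digit_binomial d M n.
Proof.
move=> MN nM; rewrite /digit_binomial.
rewrite -!(big_mkord xpredT (fun i => 'C(d i, nat_digit p n i))).
rewrite (big_cat_nat (leq0n M) MN) /= [X in (_ * X)%N]big_nat.
rewrite [X in (_ * X)%N]big1 ?muln1 // => i /andP[Mi _].
by rewrite nat_digit_small ?bin0 // (leq_trans nM) // leq_pexp2l ?prime_gt0.
Qed.

Lemma digit_binomialE d M N n : (n < p ^ M)%N -> (n < p ^ N)%N ->
  digit_binomial d M n = digit_binomial d N n.
Proof.
by move=> nM nN; have [MN|NM] := leqP M N;
  [rewrite [RHS](digit_binomial_widen d MN)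
  |rewrite (digit_binomial_widen d (ltnW NM))].
Qed.

Lemma digit_binomial_top d q r N : (q < p)%N -> (r < p ^ N)%N ->
  digit_binomial d N.+1 (q * p ^ N + r) = (digit_binomial d N r * 'C(d N, q))%N.
Proof.
move=> qp rN; rewrite /digit_binomial big_ord_recr /= nat_digit_top //.
by congr (_ * _)%N; apply: eq_bigr => i _; rewrite nat_digit_low.
Qed.

(** The only nonzero digit of [p ^ i] is a 1 at index [i]. This is why the coefficient of index
    [p ^ i] reveals the digit [d i]. *)
Lemma digit_binomial_expn d i : digit_binomial d (p ^ i) (p ^ i) = d i.
Proof.
have p1 := prime_gt1 p_pr.
have iS : (p ^ i < p ^ i.+1)%N by rewrite ltn_exp2l.
rewrite (digit_binomialE d (ltn_expl _ p1) iS).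
have q0 : (0 < p ^ i)%N by rewrite expn_gt0 prime_gt0.
have := @digit_binomial_top d 1 0 i p1 q0.
rewrite mul1n addn0 bin1 => ->.
rewrite /digit_binomial big1 ?mul1n // => j _.
by rewrite /nat_digit div0n mod0n bin0.
Qed.

Lemma digit_binomial0 d : digit_binomial d 0 0 = 1%N.
Proof. by rewrite /digit_binomial big_ord0. Qed.

End Digits.

(** * Solving the coefficient recursion in a domain of characteristic [p] *)

Section Coefficients.
Variables (p : nat) (A : comNzRingType).
Hypothesis hp : p \in [pchar A].
Hypothesis domA : GRing.integral_domain_axiom A.
Variable a : nat -> A.
Hypothesis a0 : a 0 = 1.
Hypothesis arec : forall i n,
  a (n + p ^ i)%N *+ 'C(n + p ^ i, p ^ i) + a n *+ 'C(n, p ^ i)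
  = a (p ^ i)%N * a n.

Let p_pr : prime p := pcharf_prime hp.

Lemma natr_modn_eq m n : m = n %[mod p] -> m%:R = n%:R :> A.
Proof. by move=> mn; rewrite -(GRing.natr_mod_pchar hp m) mn GRing.natr_mod_pchar. Qed.

(** This is [arec] at [n = q * p ^ i + r], where the two binomials reduce to [q + 1] and [q] modulo
    [p]. *)
Lemma coef_step i q r : (r < p ^ i)%N ->
  q.+1%:R * a (q.+1 * p ^ i + r)%N = (a (p ^ i)%N - q%:R) * a (q * p ^ i + r)%N.
Proof.
move=> ri; have q0 : (0 < p ^ i)%N by rewrite expn_gt0 prime_gt0.
have := arec i (q * p ^ i + r).
rewrite -[a (_ + _ + _)%N *+ _]mulr_natl -[a (_ + _)%N *+ _]mulr_natl addnAC -mulSnr.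
rewrite !(natr_modn_eq (bin_expn_mod p_pr _ _)) !divnMDl // !divn_small //.
by rewrite !addn0 mulrBl => <-; rewrite addrK.
Qed.

Lemma mulA_neq0 (x y : A) : x != 0 -> y != 0 -> x * y != 0.
Proof.
by move=> x0 y0; apply/eqP => /domA/orP[]; apply/negP.
Qed.

(** Otherwise every factor [a (p ^ i) - d] with [d < p] is nonzero, and [coef_step] propagates
    non-vanishing from [a 0 = 1] to all [a (j * p ^ i)] with [j < p]. *)
Lemma coef_expn_Fp i : exists2 d, (d < p)%N & a (p ^ i)%N = d%:R.
Proof.
have q0 : (0 < p ^ i)%N by rewrite expn_gt0 prime_gt0.
apply: contrapT => H.
have ne d : (d < p)%N -> a (p ^ i)%N - d%:R != 0.
  by move=> dp; apply/eqP => /eqP; rewrite subr_eq0 => /eqP ad; apply: H; exists d.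
have an0 j : (j < p)%N -> a (j * p ^ i + 0)%N != 0.
  elim: j => [|j IHj] jp; first by rewrite mul0n a0 oner_neq0.
  apply/eqP => aj; have := mulA_neq0 (ne j (ltnW jp)) (IHj (ltnW jp)).
  by rewrite -coef_step // aj mulr0 eqxx.
(* At [q = p - 1] the left factor in [coef_step] is [p], hence 0 in [A], while the right-hand side
   is nonzero. *)
have p1 : (p.-1 < p)%N by rewrite prednK ?prime_gt0.
have := mulA_neq0 (ne _ p1) (an0 _ p1).
by rewrite -coef_step // prednK ?prime_gt0 // (pcharf0 hp) mul0r eqxx.
Qed.

(** Outer induction on the number of digits, inner induction on the top digit [q]: both sides obey
    the same recursion in [q], and [q + 1 < p] can be cancelled in a domain. *)
Lemma coef_digits (d : nat -> nat) : (forall i, a (p ^ i)%N = (d i)%:R) ->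
  forall N n, (n < p ^ N)%N -> a n = (digit_binomial p d N n)%:R.
Proof.
move=> ad; elim=> [|N IHN] n nN.
  by move: nN; rewrite expn0 ltnS leqn0 => /eqP ->; rewrite a0 digit_binomial0.
have q0 : (0 < p ^ N)%N by rewrite expn_gt0 prime_gt0.
rewrite (divn_eq n (p ^ N)).
have : (n %% p ^ N < p ^ N)%N by rewrite ltn_mod.
have : (n %/ p ^ N < p)%N by rewrite ltn_divLR // -expnS.
move: (n %/ p ^ N)%N (n %% p ^ N)%N => q r qp rN {n nN}.
rewrite digit_binomial_top // natrM -IHN //.
elim: q qp => [|q IHq] qp; first by rewrite bin0 mulr1.
have qn0 : q.+1%:R != 0 :> A by rewrite -(dvdn_pcharf hp) gtnNdvd.
(* The subtraction in [mul_bin_left] truncates when [d N < q], but then ['C(d N, q)] is 0. *)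
have E : q.+1%:R * 'C(d N, q.+1)%:R = ((d N)%:R - q%:R) * 'C(d N, q)%:R :> A.
  rewrite -natrM mul_bin_left natrM; have [qd|dq] := leqP q (d N).
    by rewrite natrB.
  by rewrite bin_small // !mulr0.
have : q.+1%:R * (a (q.+1 * p ^ N + r)%N - a r * 'C(d N, q.+1)%:R) = 0.
  rewrite mulrBr coef_step // IHq ?(ltnW qp) // ad.
  by rewrite mulrCA [X in _ - X]mulrCA E subrr.
by move=> /domA; rewrite (negPf qn0) /= subr_eq0 => /eqP.
Qed.

End Coefficients.

(** * Characters and p-adic powers *)

Section Expansions.
Variables (R : realType) (K : fieldType) (abs : K -> R).
Hypothesis hK : local_field abs.
Variables (A : comUnitAlgType K) (nrm : A -> R).
Hypothesis hA : banach_algebra abs nrm.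

Let hn : ultrametric_norm nrm := ba_norm hA.
Let ha : ultrametric_norm abs := lf_norm hK.

(** The point [r] fixes a closed disc containing [y] on which convergence at [r] controls all terms;
    [y] itself serves unless it is 0. *)
Lemma dominating_element (y : K) (e : R) : abs y < e ->
  exists r, [/\ r != 0, abs y <= abs r & abs r < e].
Proof.
move=> ye; have [->|y0] := eqVneq y 0; last by exists y.
have [r r0 re] := small_element hK (le_lt_trans (ultra_ge0 ha y) ye).
by exists r; split=> //; rewrite (ultra_norm0 ha) (ultra_ge0 ha).
Qed.

Lemma hyperderiv_sums_exist (b : nat -> A) (r y : K) : r != 0 ->
  abs y <= abs r -> null_seq nrm (fun n => r ^+ n *: b n) ->
  exists g : nat -> A, forall j,
    has_sum nrm (fun n => y ^+ (n - j) *: (b n *+ 'C(n, j))) (g j).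
Proof.
move=> r0 yr hr; suff /choice[g hg] : forall j, exists l : A,
    has_sum nrm (fun n => y ^+ (n - j) *: (b n *+ 'C(n, j))) l by exists g.
move=> j; apply: (null_seq_has_sum hn (ba_complete hA)).
exact: (hyperderiv_terms_null hK hA) r0 yr hr.
Qed.

(** [hyperderiv] may select an expansion about any centre [z0]. Recentering it at 1 and comparing
    with the given expansion shows that the value is [a k] in every case. *)
Lemma hyperderiv_at1 (f : K -> A) (a : nat -> A) (e : R) k : 0 < e ->
  (forall x, abs x < e -> abs x < 1 ->
     has_sum nrm (fun n => x ^+ n *: a n) (f (1 + x))) ->
  hyperderiv abs nrm (principal_units abs) f k 1 = a k.
Proof.
move=> e0 hf; have U1 := principal_units1 hK.
have uniq v : is_hyperderiv abs nrm (principal_units abs) f k 1 v -> v = a k.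
  move=> [z0 [b [e' [z0U _ fz0 z0e' hv]]]].
  have z01 : abs (1 - z0) < 1.
    by rewrite (ultra_distC ha); apply/principal_unitsP.
  have : abs (1 - z0) < Num.min e' 1 by rewrite lt_min z0e'.
  move=> /dominating_element[r [r0 yr]]; rewrite lt_min => /andP[re' r1].
  have fsum x : abs x <= abs r ->
      has_sum nrm (fun n => x ^+ n *: b n) (f (z0 + x)).
    move=> xr; have := fz0 (z0 + x); rewrite addrAC subrr add0r; apply.
      apply/principal_unitsP => //; rewrite addrAC (ultra_add_lt ha) //.
        by rewrite (ultra_distC ha).
      exact: le_lt_trans xr r1.
    exact: le_lt_trans xr re'.
  have hr := has_sum_null_seq hn (fsum r (lexx _)).
  have [g hg] := hyperderiv_sums_exist r0 yr hr.
  rewrite (has_sum_unique hn hv (hg k)).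
  have e1 : 0 < Num.min e (abs r) by rewrite lt_min e0 (abs_gt0 hK).
  apply: (power_series_unique hK hA (f := fun x => f (1 + x)) e1) => x;
    rewrite lt_min => /andP[xe xr]; last first.
    by apply: hf => //; apply: lt_trans xr r1.
  apply: (has_sum_recenter hK hA r0 (ltW xr) yr hr _ hg).
  have -> : 1 + x = z0 + (1 - z0 + x) by rewrite addrA addrCA subrr addr0.
  by apply: fsum; rewrite (ultra_add_le ha) // ltW.
(* The given expansion about 1 is itself a witness, so [xget] does not fall back on its default
   value. *)
apply: uniq; apply: xgetPex; exists (a k); exists 1, a, e; split=> //.
- move=> z zU z1; rewrite -[in f z](subrK 1 z) [in f _]addrC.
  by apply: hf => //; apply/principal_unitsP.
- by rewrite subrr (ultra_norm0 ha).
(* Only [n = k] survives: above [k] the power of [1 - 1] vanishes, and below [k], where [n - k]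
   truncates to 0, the binomial does. *)
have := @has_sum_single _ _ _ hn
  (fun n => (1 - 1 : K) ^+ (n - k) *: (a n *+ 'C(n, k))) k.
rewrite subnn expr0 scale1r binn mulr1n; apply=> n.
rewrite neq_ltn => /orP[nk|kn]; first by rewrite bin_small // mulr0n scaler0.
by rewrite subrr expr0n subn_eq0 leqNgt kn scale0r.
Qed.

(** * Power series coefficients of a character near 1 *)

Variable chi : K -> A.
Hypothesis chi_unit : {in principal_units abs, forall z, chi z \is a GRing.unit}.
Hypothesis chiM : {in principal_units abs &, {morph chi : z w / z * w}}.
Variables (a : nat -> A) (e : R).
Hypotheses (e0 : 0 < e) (e1 : e <= 1).
Hypothesis chi_sum : forall x, abs x < e ->
  has_sum nrm (fun n => x ^+ n *: a n) (chi (1 + x)).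

Lemma character1 : chi 1 = 1.
Proof.
have U1 := principal_units1 hK.
by apply: (mulrI (chi_unit U1)); rewrite -chiM // !mulr1.
Qed.

Lemma characterX z n : z \in principal_units abs -> chi (z ^+ n) = chi z ^+ n.
Proof.
move=> zU; elim: n => [|n IHn]; first exact: character1.
by rewrite !exprS chiM ?IHn // (principal_unitsX hK).
Qed.

Lemma character_coef0 : a 0 = 1.
Proof.
have h0 : abs 0 < e by rewrite (ultra_norm0 ha).
have := chi_sum h0; rewrite addr0 character1 => h1.
have := has_sum_unique hn h1 (@has_sum_single _ _ _ hn _ 0%N _).
rewrite expr0 scale1r => H; apply/esym/H => n n0.
by rewrite expr0n (negPf n0) scale0r.
Qed.

(* Compare the coefficients of x^j in chi((1 + y)(1 + x)) = chi(1 + y) chi(1 + x). *)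
Lemma character_hyperderiv (y : K) j : abs y < e -> exists2 g : A,
  has_sum nrm (fun n => y ^+ (n - j) *: (a n *+ 'C(n, j))) g &
  (1 + y) ^+ j *: g = chi (1 + y) * a j.
Proof.
move=> ye; have [r [r0 yr re]] := dominating_element ye.
have hr := has_sum_null_seq hn (chi_sum re).
have [g hg] := hyperderiv_sums_exist r0 yr hr.
exists (g j) => //; move: j.
have r1 : 0 < abs r by rewrite (abs_gt0 hK).
have yU : 1 + y \in principal_units abs.
  by apply: principal_units_add1; rewrite // (lt_le_trans ye).
apply: (power_series_unique hK hA (f := fun x => chi ((1 + y) * (1 + x))) r1).
  (* As [(1 + y) * (1 + x) = 1 + (y + x * (1 + y))], recentering at [y] uses the increment
     [x * (1 + y)], of the same size as [x]. *)
  move=> x xr; have xyr : abs (x * (1 + y)) <= abs r.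
    by rewrite (lf_absM hK) (abs_principal_unit hK yU) mulr1 ltW.
  apply: has_sum_eq (has_sum_recenter hK hA r0 xyr yr hr _ hg).
    by move=> k /=; rewrite exprMn scalerA.
  have -> : (1 + y) * (1 + x) = 1 + (y + x * (1 + y)).
    by rewrite mulrDr mulr1 addrA (mulrC x).
  by apply: chi_sum; rewrite (le_lt_trans _ re) // (ultra_add_le ha).
move=> x xr; have xe := lt_trans xr re.
rewrite chiM //; last by rewrite (principal_units_add1 hK) // (lt_le_trans xe).
by apply: has_sum_eq (has_sum_mull hA _ (chi_sum xe)) => k; rewrite scalerAr.
Qed.

Variable p : nat.
Hypothesis hp : p \in [pchar K].

Lemma character_coef_rec i n :
  a (n + p ^ i)%N *+ 'C(n + p ^ i, p ^ i) + a n *+ 'C(n, p ^ i)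
  = a (p ^ i)%N * a n.
Proof.
move: n; set m := (p ^ i)%N.
apply: (power_series_unique hK hA (f := fun y => a m * chi (1 + y)) e0) => y ye.
  have [g hg E] := character_hyperderiv m ye.
  rewrite mulrC -E.
  have -> : (1 + y) ^+ m = 1 + y ^+ m.
    rewrite exprDn_pchar ?expr1n //.
    by rewrite pnatX pnatE ?hp // (pcharf_prime hp).
  rewrite scalerDl scale1r.
  (* The terms of index below [m] vanish with their binomials, so reindexing by [m] loses
     nothing. *)
  have shift : has_sum nrm
      (fun n => y ^+ n *: (a (n + m)%N *+ 'C(n + m, m))) g.
    apply: has_sum_eq (has_sum_shift hn (m := m) _ hg) => n /=.
      by rewrite addnK.
    by move=> nm; rewrite bin_small // mulr0n scaler0.
  (* Without reindexing, the factor [y ^+ m] restores the exponent [n]. *)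
  have sum2 := has_sum_scaler hA (y ^+ m) hg.
  refine (has_sum_eq _ (has_sumD hn shift sum2)) => n.
  rewrite /= scalerDr; congr (_ + _); rewrite scalerA -exprD.
  have [nm|mn] := ltnP n m; first by rewrite bin_small // mulr0n !scaler0.
  by rewrite subnKC.
by apply: has_sum_eq (has_sum_mull hA (a m) (chi_sum ye)) => n; rewrite scalerAr.
Qed.

End Expansions.

Lemma Fp_incl_nat (p : nat) (S : nzRingType) n : p \in [pchar S] ->
  Fp_incl S (n%:R : 'F_p) = n%:R.
Proof.
move=> hS; rewrite /Fp_incl val_Fp_nat ?GRing.natr_mod_pchar //.
exact: pcharf_prime hS.
Qed.

Lemma Fp_incl_padic_binomial (p : nat) (S : nzRingType) (c : padic_int p) n :
  p \in [pchar S] ->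
  Fp_incl S (padic_binomial c n) = (digit_binomial p (padic_digit c) n n)%:R.
Proof. exact: Fp_incl_nat. Qed.

(** * The maps [z ^ c] on principal units *)

Section PadicPower.
Variables (R : realType) (K : fieldType) (abs : K -> R).
Hypothesis hK : local_field abs.
Variable p : nat.
Hypothesis hp : p \in [pchar K].

Let ha : ultrametric_norm abs := lf_norm hK.
Let p_pr : prime p := pcharf_prime hp.

Lemma padic_power_term_le (c : padic_int p) z n :
  abs (padic_power_term c z n) <= abs (z - 1) ^+ n.
Proof.
rewrite (lf_absM hK) (absX hK) ler_piMl ?exprn_ge0 ?(ultra_ge0 ha) //.
by rewrite (le_trans (ultra_muln_le ha _ _)) // (abs1 hK).
Qed.

(** The terms are dominated by a geometric sequence of ratio [abs (z - 1) < 1], so [padic_power] is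
    a true sum and not the default value of [infsum]. *)
Lemma padic_power_sum (c : padic_int p) z : z \in principal_units abs ->
  has_sum abs (padic_power_term c z) (padic_power abs c z).
Proof.
move=> /(principal_unitsP hK) z1.
suff [l hl] : exists l, has_sum abs (padic_power_term c z) l.
  by rewrite /padic_power (has_sum_infsum ha hl).
apply: (null_seq_has_sum ha (lf_complete hK)) => e e0.
have tR : 0 <= abs (z - 1) < 1 by rewrite (ultra_ge0 ha).
have [N Nt] := expr_lt_eventually tR e0; exists N => n /Nt.
exact/le_lt_trans/padic_power_term_le.
Qed.

Lemma padic_power_principal_unit (c : padic_int p) z :
  z \in principal_units abs -> padic_power abs c z \in principal_units abs.
Proof.
move=> zU; have hz := padic_power_sum c zU.
move: zU => /(principal_unitsP hK) z1; apply/(principal_unitsP hK).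
apply: (le_lt_trans _ z1).
(* The term of index 0 is 1, and all later ones are at most [abs (z - 1)]. *)
have := has_sum_tail_le ha (N := 1) (e := abs (z - 1)) (ultra_ge0 ha _) _ hz.
rewrite big_ord1 {2}/padic_power_term Fp_incl_padic_binomial //.
rewrite digit_binomial0 mul1r expr0; apply=> n n0.
rewrite (le_trans (padic_power_term_le _ _ _)) //.
by rewrite ler_iXnr ?(ultra_ge0 ha) // ltW.
Qed.

Lemma expr_pchar_sub1 (z : K) : z ^+ p - 1 = (z - 1) ^+ p.
Proof. by rewrite -!(pFrobenius_autE hp) rmorphB rmorph1. Qed.

(** Frobenius is additive and continuous and fixes the coefficients, which come from the prime
    field, so it may be applied term by term. *)
Lemma padic_power_Frobenius (c : padic_int p) z : z \in principal_units abs ->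
  padic_power abs c (z ^+ p) = padic_power abs c z ^+ p.
Proof.
move=> zU; rewrite -[RHS](pFrobenius_autE hp).
apply: (has_sum_unique ha (padic_power_sum c (principal_unitsX hK p zU))).
apply: has_sum_eq (has_sum_map (f := pFrobenius_aut hp) ha ha _
  (padic_power_sum c zU)) => [n|e e0] /=.
  rewrite /padic_power_term rmorphM rmorph_nat rmorphXn rmorphB rmorph1.
  by [].
(* The bound [abs x ^+ p <= abs x] is available inside the unit disc, hence the minimum with 1. *)
exists (Num.min e 1) => [|x]; first by rewrite lt_min e0 ltr01.
rewrite lt_min => /andP[xe x1]; rewrite pFrobenius_autE (absX hK).
by rewrite (le_lt_trans _ xe) // ler_iXnr ?prime_gt0 ?(ultra_ge0 ha) // ltW.
Qed.

End PadicPower.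

(** [x ^+ p - y ^+ p] is the [p]-th power of [x - y], and a domain has no nonzero nilpotents. *)
Lemma expr_pchar_inj (p : nat) (A : comNzRingType) : p \in [pchar A] ->
  GRing.integral_domain_axiom A -> injective (fun x : A => x ^+ p).
Proof.
move=> hp domA x y /= xy; apply/eqP; rewrite -subr_eq0; apply: contraT => d0.
have dX n : (x - y) ^+ n != 0.
  by elim: n => [|n IHn]; rewrite ?oner_neq0 // exprS mulA_neq0.
have E : (x - y) ^+ p = x ^+ p - y ^+ p := rmorphB (pFrobenius_aut hp) x y.
by have := dX p; rewrite E xy subrr eqxx.
Qed.

Lemma natr_pchar_inj (p : nat) (A : nzRingType) m n : p \in [pchar A] ->
  (m < p)%N -> (n < p)%N -> m%:R = n%:R :> A -> m = n.
Proof.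
move=> hp; wlog mn : m n / (m <= n)%N.
  move=> H mp np E; have [/H|/ltnW/H] := leqP m n; first exact.
  by move=> nm; apply/esym/nm.
move=> mp np /eqP; rewrite eq_sym -subr_eq0 -natrB // -(dvdn_pcharf hp).
move=> pd; apply/eqP; rewrite eqn_leq mn -subn_eq0 -leqn0 leqNgt.
by apply/negP => /dvdn_leq/(_ pd); rewrite leqNgt (leq_ltn_trans (leq_subr _ _)).
Qed.

Theorem theoremB2p2 (R : realType) (p : nat)
  (K : fieldType) (abs : K -> R)
  (hK : local_field abs) (hp : p \in [pchar K])
  (A : comUnitAlgType K) (nrm : A -> R)
  (hA : banach_algebra abs nrm) (domA : GRing.integral_domain_axiom A)
  (chi : K -> A)
  (chi_unit : {in principal_units abs, forall z, chi z \is a GRing.unit})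
  (chiM : {in principal_units abs &, {morph chi : z w / z * w}})
  (chi_an : locally_analytic abs nrm (principal_units abs) chi) :
  (exists chi0 : K -> K,
     [/\ {in principal_units abs, forall z, chi0 z \in principal_units abs},
         {in principal_units abs &, {morph chi0 : z w / z * w}}
       & {in principal_units abs, forall z, chi z = (chi0 z)%:A}]) /\
  (exists c : padic_int p,
     [/\ {in principal_units abs, forall z,
           has_sum abs (padic_power_term c z) (padic_power abs c z) /\
           chi z = (padic_power abs c z)%:A},
         (forall i : nat, exists2 a : 'F_p,
           hyperderiv abs nrm (principal_units abs) chi (p ^ i)%N 1
             = Fp_incl A a
           & (padic_digit c i)%:R = a),
         (forall c' : padic_int p,
           {in principal_units abs, forall z,
             chi z = (padic_power abs c' z)%:A} -> c' = c)
       & (forall c' : padic_int p,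
           (forall i : nat,
             hyperderiv abs nrm (principal_units abs) chi (p ^ i)%N 1
               = Fp_incl A ((padic_digit c' i)%:R : 'F_p)) -> c' = c)]).
Proof.
have hn := ba_norm hA; have ha := lf_norm hK.
have hpA : p \in [pchar A] by rewrite pchar_lalg.
have p_pr : prime p := pcharf_prime hp.
have [a [e' [e'0 ha1]]] := chi_an _ (principal_units1 hK).
(* The radius is cut down to at most 1 so that [1 + x] is a principal unit whenever [abs x < e]. *)
pose e := Num.min e' 1.
have e0 : 0 < e by rewrite lt_min e'0 ltr01.
have e1 : e <= 1 by rewrite ge_min lexx orbT.
have chi_sum x : abs x < e ->
    has_sum nrm (fun n => x ^+ n *: a n) (chi (1 + x)).
  rewrite lt_min => /andP[xe' x1].
  have := ha1 (1 + x) (principal_units_add1 hK x1).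
  by rewrite addrAC subrr add0r; apply.
have a0 := character_coef0 hK hA chi_unit chiM e0 chi_sum.
have arec := character_coef_rec hK hA chiM e0 e1 chi_sum hp.
have /choice[d hd] i : exists m : nat, (m < p)%N /\ a (p ^ i)%N = m%:R.
  by have [m mp am] := coef_expn_Fp hpA domA a0 arec i; exists m.
have dp i : (d i < p)%N by case: (hd i).
pose c := padic_of_digits dp.
have cd i : padic_digit c i = d i by rewrite padic_of_digitsE.
have aE n : a n = Fp_incl A (padic_binomial c n).
  rewrite Fp_incl_padic_binomial //.
  apply: (coef_digits hpA domA a0 arec) => [i|].
    by rewrite cd; case: (hd i).
  by rewrite ltn_expl ?prime_gt1.
have power_alg (c' : padic_int p) z : z \in principal_units abs ->
    has_sum nrm (fun n => (z - 1) ^+ n *: Fp_incl A (padic_binomial c' n))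
      (padic_power abs c' z)%:A.
  move=> zU; have := has_sum_alg hK hA (padic_power_sum hK c' zU).
  apply: has_sum_eq => n; rewrite /padic_power_term /Fp_incl mulr_natl -scalerMnl.
  by rewrite scalerMnr.
have chi_near z : z \in principal_units abs -> abs (z - 1) < e ->
    chi z = (padic_power abs c z)%:A.
  move=> zU ze; apply/esym/(has_sum_unique hn (power_alg c z zU)).
  have := chi_sum _ ze; rewrite addrCA subrr addr0; apply: has_sum_eq => n.
  by rewrite aE.
(* Replacing [z] by [z ^+ p] raises [abs (z - 1)] to the power [p], so [k] such steps reach the disc
   of radius [e]; injectivity of Frobenius on [A] carries the identity back to [z]. *)
have chi_c k z : z \in principal_units abs -> abs (z - 1) ^+ (p ^ k) < e ->
    chi z = (padic_power abs c z)%:A.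
  elim: k z => [|k IHk] z zU; first by rewrite expn0 expr1; apply: chi_near.
  rewrite expnS exprM -(absX hK) -(expr_pchar_sub1 hp) => /IHk.
  rewrite (principal_unitsX hK) // => /(_ isT).
  rewrite (characterX hK chi_unit chiM) // (padic_power_Frobenius hK hp) //.
  set w := padic_power abs c z.
  have -> : (w ^+ p)%:A = w%:A ^+ p :> A by rewrite exprZn expr1n.
  exact: (expr_pchar_inj hpA domA).
have chiE z : z \in principal_units abs -> chi z = (padic_power abs c z)%:A.
  move=> zU; have /(principal_unitsP hK) z1 := zU.
  have tR : 0 <= abs (z - 1) < 1 by rewrite (ultra_ge0 ha).
  have [N Nt] := expr_lt_eventually tR e0.
  by apply: (chi_c N) => //; apply/Nt/ltnW/ltn_expl/prime_gt1.
have hyperE i : hyperderiv abs nrm (principal_units abs) chi (p ^ i)%N 1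
    = Fp_incl A ((padic_digit c i)%:R : 'F_p).
  rewrite (hyperderiv_at1 hK hA (a := a) _ e0) => [|x xe _]; last exact: chi_sum.
  by rewrite Fp_incl_nat // cd; case: (hd i).
have uniq (c' : padic_int p) : (forall i : nat,
    hyperderiv abs nrm (principal_units abs) chi (p ^ i)%N 1
      = Fp_incl A ((padic_digit c' i)%:R : 'F_p)) -> c' = c.
  move=> hc'; apply: padic_digit_inj => i.
  apply: (natr_pchar_inj hpA); rewrite ?padic_digit_lt //.
  by have := hc' i; rewrite hyperE !Fp_incl_nat.
split.
  exists (padic_power abs c); split=> [z|z w zU wU|z]; last exact: chiE.
    exact: padic_power_principal_unit.
  (* Multiplicativity is inherited from [chi] through the injection of [K] into [A]. *)
  apply: (fmorph_inj (in_alg A)).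
  have zwU := principal_unitsM hK zU wU.
  by rewrite rmorphM /= -!chiE // chiM.
exists c; split=> [z zU|i|c' hc'|//].
- by split; [exact: padic_power_sum|exact: chiE].
- by exists (padic_digit c i)%:R.
(* The series for [c'] expands [chi] on the whole open unit disc around 1, so its coefficient of
   index [p ^ i], the digit of [c'], is the hyperderivative. *)
apply: uniq => i.
rewrite (hyperderiv_at1 hK hA (a := fun n => Fp_incl A (padic_binomial c' n)) _ ltr01).
  by rewrite Fp_incl_padic_binomial // digit_binomial_expn // Fp_incl_nat.
move=> x x1 _; have xU := principal_units_add1 hK x1.
have := power_alg c' _ xU; rewrite -hc' //.
by apply: has_sum_eq => n; rewrite addrAC subrr add0r.
Qed.
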